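(* Let $f\colon X\to X$ be a cellular self-map of a finite connected CW complex. If $N'\subseteq N$ are finite observers for $f$, then $$R_N(f)\le R_{N'}(f),\qquad V_N(f)\le V_{N'}(f),\qquad M_N(f)\le M_{N'}(f).$$ Consequently, both the collision defect $\mathrm{col}_N(f)$ and the cancellation mass $\mathrm{can}_N(f)$ are nonincreasing under refinement (i.e. $\mathrm{col}_{N'}(f)\le\mathrm{col}_N(f)$ and $\mathrm{can}_{N'}(f)\le\mathrm{can}_N(f)$ when $N'\subseteq N$). Moreover, $\mathrm{can}_N(f)$ is a nonnegative integer.
   Context: Let $G=\pi_1(X,x_0)$. A choice of lift $\tilde f$ of $f$ to the universal cover $p\colon\tilde X\to X$ determines $\phi\in\mathrm{End}(G)$ with $\tilde f(g\tilde x)=\phi(g)\tilde f(\tilde x)$. Write $a\sim_\phi b$ if $b=ga\phi(g)^{-1}$ for some $g\in G$; $\mathcal R(\phi)$ is the set of classes. The Reidemeister trace is $\mathrm{RT}(f)=\sum_{\alpha}I_f(\alpha)[\alpha]\in\mathbb Z[\mathcal R(\phi)]$, where for $\alpha=[a]$, $I_f(\alpha)$ is the fixed-point index of the fixed-point class $p(\mathrm{Fix}(a\tilde f))$. Its finite support is $E_f$; $N(f)=\#E_f$. A finite observer is a finite-index normal subgroup $N\triangleleft G$ with $\phi(N)\subseteq N$; with $q_N\colon G\to G/N$ and induced $\bar\phi_N$, it gives $(q_N)_R\colon\mathcal R(\phi)\to\mathcal R(\bar\phi_N)$, $[a]\mapsto[q_N(a)]$, and the observed trace $\mathrm{RT}_N(f)$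 is the pushforward of $\mathrm{RT}(f)$ along $(q_N)_R$. Put $R_N(f)=\#(q_N)_R(E_f)$, $V_N(f)=\#\mathrm{supp}\,\mathrm{RT}_N(f)$, $M_N(f)=\|\mathrm{RT}_N(f)\|_1$ (sum of absolute values of coefficients), $\mathrm{col}_N(f)=N(f)-R_N(f)$, and $\mathrm{can}_N(f)=\frac12\left(\|\mathrm{RT}(f)\|_1-M_N(f)\right)$. *)

(* Defs.v *)
From HB Require Import structures.
From mathcomp Require Import all_boot all_order all_algebra monoid generic_quotient.
From mathcomp Require Import finmap lra.
From mathcomp Require Import all_classical all_reals all_analysis.

Set Implicit Arguments.
Unset Strict Implicit.
Unset Printing Implicit Defensive.

Import Order.TTheory GRing.Theory Num.Theory numFieldNormedType.Exports.

Local Open Scope classical_set_scope.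
Local Open Scope ring_scope.
Local Open Scope quotient_scope.

(* A path is a continuous map [R -> X] of which only the restriction to [0, 1]
   matters: a map continuous on [0, 1] extends to [R] by constants.  The same
   convention is used for homotopies, which are parametrized by [R * R]. *)

Definition path_homotopic (R : realType) (X : topologicalType)
    (gamma delta : R -> X) : Prop :=
  exists H : R * R -> X,
    [/\ continuous H,
        forall t : R, 0 <= t <= 1 -> H (0, t) = gamma t,
        forall t : R, 0 <= t <= 1 -> H (1, t) = delta t &
        forall s : R, 0 <= s <= 1 -> H (s, 0) = gamma 0 /\ H (s, 1) = gamma 1].

Definition path_connected (R : realType) (X : topologicalType) : Prop :=
  forall x y : X, exists gamma : R -> X,
    [/\ continuous gamma, gamma 0 = x & gamma 1 = y].

Definition simply_connected (R : realType) (X : topologicalType) : Prop :=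
  path_connected R X /\
  forall gamma : R -> X, continuous gamma -> gamma 0 = gamma 1 ->
    path_homotopic gamma (cst (gamma 0)).

Record loop (R : realType) (X : topologicalType) (x0 : X) := Loop {
  loop_fun :> R -> X;
  loop_continuous : continuous loop_fun;
  loop0 : loop_fun 0 = x0;
  loop1 : loop_fun 1 = x0 }.

HB.instance Definition _ (R : realType) (X : topologicalType) (x0 : X) :=
  gen_eqMixin (loop R x0).
HB.instance Definition _ (R : realType) (X : topologicalType) (x0 : X) :=
  gen_choiceMixin (loop R x0).

Section homotopy_lemmas.
Context {R : realType} {X : topologicalType}.
Implicit Types (gamma delta eta : R -> X).

Let glue_continuous (T : topologicalType) (c : T -> R) (F G : T -> X) :
  continuous c -> continuous F -> continuous G ->
  (forall z, c z = 2^-1 -> F z = G z) ->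
  continuous (fun z => if c z <= 2^-1 then F z else G z).
Proof.
move=> cc cF cG FG z.
move=> A; have [lt|gt|eq] := ltgtP (c z) 2^-1 => nA;
  change (nbhs z (fun w => A (if c w <= 2^-1 then F w else G w))).
- have : \forall w \near z, c w < 2^-1 by exact: (cc z _ (lt_nbhsl lt)).
  move=> ltw; have nF : nbhs z (F @^-1` A) by exact: (cF z _ nA).
  by apply: filterS (filterI ltw nF) => w [/= /ltW ->].
- have : \forall w \near z, 2^-1 < c w by exact: (cc z _ (lt_nbhsr gt)).
  move=> gtw; have nG : nbhs z (G @^-1` A) by exact: (cG z _ nA).
  by apply: filterS (filterI gtw nG) => w [/=]; rewrite ltNge => /negbTE ->.
- have nF : nbhs z (F @^-1` A) by exact: (cF z _ nA).
  have nG : nbhs z (G @^-1` A) by apply: cG; rewrite -(FG z eq).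
  apply: filterS (filterI nF nG) => w [/= Fw Gw].
  by case: ifP.
Qed.

Let cont_comp (A B D : topologicalType) (f : A -> B) (g : B -> D) :
  continuous f -> continuous g -> continuous (fun z => g (f z)).
Proof. by move=> cf cg z; apply: (continuous_comp (cf z)); exact: cg. Qed.

Let cont_pair (A B D : topologicalType) (f : A -> B) (g : A -> D) :
  continuous f -> continuous g -> continuous (fun z => (f z, g z)).
Proof. by move=> cf cg z; apply: cvg_pair; [exact: cf|exact: cg]. Qed.

Let cont_fst (A B : topologicalType) : continuous (fun z : A * B => z.1).
Proof. by move=> z; exact: cvg_fst. Qed.

Let cont_snd (A B : topologicalType) : continuous (fun z : A * B => z.2).
Proof. by move=> z; exact: cvg_snd. Qed.

Let cont_add (A : topologicalType) (u v : A -> R) :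
  continuous u -> continuous v -> continuous (fun z => u z + v z).
Proof. by move=> cu cv z; apply: cvgD; [exact: cu|exact: cv]. Qed.

Let cont_sub (A : topologicalType) (u v : A -> R) :
  continuous u -> continuous v -> continuous (fun z => u z - v z).
Proof. by move=> cu cv z; apply: cvgB; [exact: cu|exact: cv]. Qed.

Let cont_mul (A : topologicalType) (u v : A -> R) :
  continuous u -> continuous v -> continuous (fun z => u z * v z).
Proof. by move=> cu cv z; apply: cvgM; [exact: cu|exact: cv]. Qed.

Let cont_cst (A B : topologicalType) (b : B) : continuous (fun _ : A => b).
Proof. by move=> z; exact: cvg_cst. Qed.

Let cont_id (A : topologicalType) : continuous (fun z : A => z).
Proof. by move=> z; exact: cvg_id. Qed.

Let clamp (s : R) : R := Num.max 0 (Num.min s 1).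

Let clamp_cont : continuous clamp.
Proof.
move=> s; apply: (@continuous_max _ _ (cst 0) (fun s : R => Num.min s 1)).
  exact: cvg_cst.
by apply: (@continuous_min _ _ idfun (cst 1)); [exact: cvg_id|exact: cvg_cst].
Qed.

Let clamp01 (s : R) : 0 <= clamp s <= 1.
Proof. by rewrite /clamp le_max lexx/= ge_max ler01 ge_min lexx orbT. Qed.

Let clamp_id (s : R) : 0 <= s <= 1 -> clamp s = s.
Proof. by move=> /andP[s0 s1]; rewrite /clamp min_l// max_r. Qed.

Lemma path_homotopic_eq gamma delta : continuous gamma ->
  (forall t : R, 0 <= t <= 1 -> gamma t = delta t) -> path_homotopic gamma delta.
Proof.
move=> cg gd; exists (fun z => gamma z.2); split => //.
by apply: cont_comp cg; exact: cont_snd.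
Qed.

Lemma path_homotopic_sym gamma delta :
  path_homotopic gamma delta -> path_homotopic delta gamma.
Proof.
case=> H [cH H0 H1 He]; exists (fun z => H (1 - z.1, z.2)); split.
- apply: cont_comp cH; apply: cont_pair; last exact: cont_snd.
  by apply: cont_sub; [exact: cont_cst|exact: cont_fst].
- by move=> t t01 /=; rewrite subr0 H1.
- by move=> t t01 /=; rewrite subrr H0.
- move=> s /andP[s0 s1] /=.
  have /He[h0 h1] : 0 <= 1 - s <= 1 by apply/andP; split; lra.
  have /He[k0 k1] : 0 <= (1 : R) <= 1 by rewrite ler01 lexx.
  by rewrite -H1 ?lexx ?ler01// -H1 ?lexx ?ler01// h0 h1 k0 k1.
Qed.

Lemma path_homotopic_trans gamma delta eta : path_homotopic gamma delta ->
  path_homotopic delta eta -> path_homotopic gamma eta.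
Proof.
case=> H [cH H0 H1 He] [K [cK K0 K1 Ke]].
have dE : delta 0 = gamma 0 /\ delta 1 = gamma 1.
  have /He[k0 k1] : 0 <= (1 : R) <= 1 by rewrite ler01 lexx.
  by rewrite -H1 ?lexx ?ler01// -H1 ?lexx ?ler01.
exists (fun z => if z.1 <= 2^-1 then H (2 * z.1, clamp z.2)
                 else K (2 * z.1 - 1, clamp z.2)); split.
- apply: (@glue_continuous _ fst (fun z => H (2 * z.1, clamp z.2))
    (fun z => K (2 * z.1 - 1, clamp z.2))).
  + exact: cont_fst.
  + apply: cont_comp cH; apply: cont_pair.
      by apply: cont_mul; [exact: cont_cst|exact: cont_fst].
    by apply: cont_comp clamp_cont; exact: cont_snd.
  + apply: cont_comp cK; apply: cont_pair.
      apply: cont_sub; last exact: cont_cst.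
      by apply: cont_mul; [exact: cont_cst|exact: cont_fst].
    by apply: cont_comp clamp_cont; exact: cont_snd.
  + by move=> z ->; rewrite divff// subrr H1// K0.
- by move=> t t01 /=; rewrite invr_ge0 ler0n mulr0 clamp_id// H0.
- move=> t t01 /=; rewrite clamp_id// ifF; last by apply/negbTE; rewrite -ltNge; lra.
  by rewrite (_ : 2 * 1 - 1 = 1) ?K1//; lra.
- move=> s /andP[s0 s1] /=; rewrite !clamp_id ?lexx ?ler01//.
  case: ifPn => [sh|]; first by apply: He; apply/andP; split; lra.
  by rewrite -ltNge => sh; rewrite -dE.1 -dE.2; apply: Ke; apply/andP; split; lra.
Qed.

Lemma path_homotopic_reparam gamma (u v : R -> R) : continuous gamma ->
  continuous u -> continuous v -> u 0 = v 0 -> u 1 = v 1 ->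
  path_homotopic (gamma \o u) (gamma \o v).
Proof.
move=> cg cu cv uv0 uv1.
exists (fun z => gamma ((1 - z.1) * u z.2 + z.1 * v z.2)); split.
- apply: cont_comp cg; apply: cont_add; apply: cont_mul.
  + by apply: cont_sub; [exact: cont_cst|exact: cont_fst].
  + by apply: cont_comp cu; exact: cont_snd.
  + exact: cont_fst.
  + by apply: cont_comp cv; exact: cont_snd.
- by move=> t _ /=; rewrite subr0 mul1r mul0r addr0.
- by move=> t _ /=; rewrite subrr mul1r mul0r add0r.
- by move=> s _ /=; rewrite -uv0 -uv1 -!mulrDl subrK !mul1r.
Qed.

Definition path_cat gamma delta (t : R) : X :=
  if t <= 2^-1 then gamma (2 * t) else delta (2 * t - 1).

Lemma path_cat_continuous gamma delta : continuous gamma -> continuous delta ->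
  gamma 1 = delta 0 -> continuous (path_cat gamma delta).
Proof.
move=> cg cd gd; apply: (@glue_continuous _ idfun (fun t => gamma (2 * t))
    (fun t => delta (2 * t - 1))).
- exact: cont_id.
- by apply: cont_comp cg; apply: cont_mul; [exact: cont_cst|exact: cont_id].
- apply: cont_comp cd; apply: cont_sub; last exact: cont_cst.
  by apply: cont_mul; [exact: cont_cst|exact: cont_id].
- by move=> t /= ->; rewrite divff// subrr.
Qed.

Lemma path_homotopic_cat gamma gamma' delta delta' : gamma 1 = delta 0 ->
  path_homotopic gamma gamma' -> path_homotopic delta delta' ->
  path_homotopic (path_cat gamma delta) (path_cat gamma' delta').
Proof.
move=> gd [H [cH H0 H1 He]] [K [cK K0 K1 Ke]].
exists (fun z => if z.2 <= 2^-1 then H (clamp z.1, 2 * z.2)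
                 else K (clamp z.1, 2 * z.2 - 1)); split.
- apply: (@glue_continuous _ snd (fun z => H (clamp z.1, 2 * z.2))
    (fun z => K (clamp z.1, 2 * z.2 - 1))).
  + exact: cont_snd.
  + apply: cont_comp cH; apply: cont_pair.
      by apply: cont_comp clamp_cont; exact: cont_fst.
    by apply: cont_mul; [exact: cont_cst|exact: cont_snd].
  + apply: cont_comp cK; apply: cont_pair.
      by apply: cont_comp clamp_cont; exact: cont_fst.
    apply: cont_sub; last exact: cont_cst.
    by apply: cont_mul; [exact: cont_cst|exact: cont_snd].
  + move=> z ->; rewrite divff// subrr (He _ (clamp01 _)).2 gd.
    by rewrite (Ke _ (clamp01 _)).1.
- move=> t /andP[t0 t1] /=; rewrite /path_cat clamp_id ?lexx ?ler01//.
  case: ifPn => [th|]; first by rewrite H0//; apply/andP; split; lra.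
  by rewrite -ltNge => th; rewrite K0//; apply/andP; split; lra.
- move=> t /andP[t0 t1] /=; rewrite /path_cat clamp_id ?lexx ?ler01//.
  case: ifPn => [th|]; first by rewrite H1//; apply/andP; split; lra.
  by rewrite -ltNge => th; rewrite K1//; apply/andP; split; lra.
- move=> s s01 /=; rewrite /path_cat clamp_id// invr_ge0 ler0n mulr0.
  rewrite (_ : ((1 : R) <= 2^-1) = false); last by apply/negbTE; rewrite -ltNge; lra.
  rewrite (_ : 2 * 1 - 1 = 1); last by lra.
  by rewrite (He _ s01).1 (Ke _ s01).2.
Qed.

Definition path_rev gamma (t : R) : X := gamma (1 - t).

Let rev_cont : continuous (fun t : R => 1 - t).
Proof. by apply: cont_sub; [exact: cont_cst|exact: cont_id]. Qed.

Lemma path_rev_continuous gamma : continuous gamma -> continuous (path_rev gamma).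
Proof.
by move=> cg; apply: cont_comp cg; exact: rev_cont.
Qed.

Lemma path_homotopic_rev gamma delta :
  path_homotopic gamma delta -> path_homotopic (path_rev gamma) (path_rev delta).
Proof.
case=> H [cH H0 H1 He]; exists (fun z => H (z.1, 1 - z.2)); split.
- apply: cont_comp cH; apply: cont_pair; first exact: cont_fst.
  by apply: cont_sub; [exact: cont_cst|exact: cont_snd].
- by move=> t /andP[t0 t1] /=; rewrite H0//; apply/andP; split; lra.
- by move=> t /andP[t0 t1] /=; rewrite H1//; apply/andP; split; lra.
- by move=> s s01 /=; rewrite /path_rev !subr0 !subrr; have [-> ->] := He _ s01.
Qed.

Let lin_cont (a b : R) : continuous (fun t : R => a * t + b).
Proof.
apply: cont_add; last exact: cont_cst.
by apply: cont_mul; [exact: cont_cst|exact: cont_id].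
Qed.

Let max_cont (u v : R -> R) : continuous u -> continuous v ->
  continuous (fun t => Num.max (u t) (v t)).
Proof. by move=> cu cv t; apply: (@continuous_max _ _ u v); [exact: cu|exact: cv]. Qed.

Let min_cont (u v : R -> R) : continuous u -> continuous v ->
  continuous (fun t => Num.min (u t) (v t)).
Proof. by move=> cu cv t; apply: (@continuous_min _ _ u v); [exact: cu|exact: cv]. Qed.

Lemma path_catA gamma delta eta : continuous gamma -> continuous delta ->
  continuous eta -> gamma 1 = delta 0 -> delta 1 = eta 0 ->
  path_homotopic (path_cat gamma (path_cat delta eta))
                 (path_cat (path_cat gamma delta) eta).
Proof.
move=> cg cd ce gd de.
pose u (t : R) : R := Num.max (2^-1 * t + 0) (Num.max (1 * t + - 4^-1) (2 * t + - 1)).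
set F := path_cat (path_cat gamma delta) eta.
have cF : continuous F.
  apply: path_cat_continuous => //; first exact: path_cat_continuous.
  rewrite /path_cat ifF; last by apply/negbTE; rewrite -ltNge; lra.
  by rewrite (_ : 2 * 1 - 1 = 1)//; lra.
have cu : continuous u by do 2?[apply: max_cont; first exact: lin_cont]; exact: lin_cont.
have uE (t : R) : u t = if t <= 2^-1 then 2^-1 * t
                  else if t <= 3 / 4 then t - 4^-1 else 2 * t - 1.
  rewrite /u mul1r addr0; case: (leP t 2^-1) => h; last case: (leP t (3 / 4)) => h'.
  - rewrite max_l// ge_max; apply/andP; split; lra.
  - rewrite max_r ?le_max; last by apply/orP; left; lra.
    by rewrite max_l//; lra.
  - rewrite max_r ?le_max; last by apply/orP; left; lra.
    by rewrite max_r//; lra.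
apply: (path_homotopic_trans (delta := F \o u)); last first.
  apply: (@path_homotopic_reparam F u idfun) => //.
  - exact: cont_id.
  - by rewrite uE invr_ge0 ler0n mulr0.
  - rewrite uE ifF; last by apply/negbTE; rewrite -ltNge; lra.
    by rewrite ifF; [rewrite /=; lra|apply/negbTE; rewrite -ltNge; lra].
apply: path_homotopic_sym; apply: path_homotopic_eq.
  by apply: cont_comp cF; exact: cu.
move=> t _ /=; rewrite uE /F /path_cat; clear gd de.
case: (leP t 2^-1) => h; last case: (leP t (3 / 4)) => h'; do ?case: leP => ?;
  first [by congr (_ _); lra | by exfalso; lra].
Qed.

Lemma path_cat1p gamma : continuous gamma ->
  path_homotopic (path_cat (cst (gamma 0)) gamma) gamma.
Proof.
move=> cg; pose u (t : R) : R := Num.max (0 * t + 0) (2 * t + - 1).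
have cu : continuous u by apply: max_cont; exact: lin_cont.
apply: (path_homotopic_trans (delta := gamma \o u)); last first.
  apply: (@path_homotopic_reparam gamma u idfun) => //.
  - exact: cont_id.
  - by rewrite /u mul0r add0r max_l//; lra.
  - by rewrite /u mul0r add0r max_r /=; lra.
apply: path_homotopic_sym; apply: path_homotopic_eq.
  by apply: cont_comp cg; exact: cu.
move=> t _ /=; rewrite /u /path_cat mul0r add0r; case: (leP t 2^-1) => h.
  by rewrite max_l//; lra.
by rewrite max_r//; lra.
Qed.

Lemma path_catp1 gamma : continuous gamma ->
  path_homotopic (path_cat gamma (cst (gamma 1))) gamma.
Proof.
move=> cg; pose u (t : R) : R := Num.min (2 * t + 0) (0 * t + 1).
have cu : continuous u by apply: min_cont; exact: lin_cont.
apply: (path_homotopic_trans (delta := gamma \o u)); last first.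
  apply: (@path_homotopic_reparam gamma u idfun) => //.
  - exact: cont_id.
  - by rewrite /u mul0r add0r min_l /=; lra.
  - by rewrite /u mul0r add0r min_r /=; lra.
apply: path_homotopic_sym; apply: path_homotopic_eq.
  by apply: cont_comp cg; exact: cu.
move=> t _ /=; rewrite /u /path_cat mul0r add0r addr0; case: (leP t 2^-1) => h.
  by rewrite min_l//; lra.
by rewrite min_r//; lra.
Qed.

Lemma path_catpV gamma : continuous gamma ->
  path_homotopic (path_cat gamma (path_rev gamma)) (cst (gamma 0)).
Proof.
move=> cg; pose u (t : R) : R := Num.min (2 * t + 0) (- 2 * t + 2).
have cu : continuous u by apply: min_cont; exact: lin_cont.
apply: (path_homotopic_trans (delta := gamma \o u)); last first.
  apply: (@path_homotopic_reparam gamma u (cst 0)) => //.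
  - exact: cont_cst.
  - by rewrite /u min_l /=; lra.
  - by rewrite /u min_r /=; lra.
apply: path_homotopic_sym; apply: path_homotopic_eq.
  by apply: cont_comp cg; exact: cu.
move=> t _ /=; rewrite /u /path_cat /path_rev; case: (leP t 2^-1) => h.
  by rewrite min_l ?addr0//; lra.
by rewrite min_r; [congr (gamma _)|]; lra.
Qed.

Lemma path_catVp gamma : continuous gamma ->
  path_homotopic (path_cat (path_rev gamma) gamma) (cst (gamma 1)).
Proof.
move=> cg.
have := path_catpV (path_rev_continuous cg).
have -> : path_rev (path_rev gamma) = gamma.
  by apply/funext => t; rewrite /path_rev; congr (gamma _); lra.
by have -> : path_rev gamma 0 = gamma 1 by rewrite /path_rev subr0.
Qed.

End homotopy_lemmas.

Section fundamental_group.
Context (R : realType) (X : topologicalType) (x0 : X).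
Implicit Types a b c : loop R x0.

Definition loop_homotopic a b : bool := `[< path_homotopic a b >].

Lemma loop_homotopic_equiv : equiv_class_of loop_homotopic.
Proof.
split=> [a|a b|b a c].
- by apply/asboolP/path_homotopic_eq => //; exact: loop_continuous.
- by apply/asboolP/asboolP => /path_homotopic_sym.
- by move=> /asboolP ab /asboolP bc; apply/asboolP; exact: path_homotopic_trans bc.
Qed.

Canonical loop_homotopic_rel := EquivRelPack loop_homotopic_equiv.

Definition pi1 := {eq_quot loop_homotopic_rel}.

HB.instance Definition _ := Choice.on pi1.
HB.instance Definition _ := EqQuotient.on pi1.

Lemma loop_cat_proof a b : a 1 = b 0.
Proof. by rewrite loop0 loop1. Qed.

Lemma loop_cat0 a b : path_cat a b 0 = x0.
Proof. by rewrite /path_cat invr_ge0 ler0n mulr0 loop0. Qed.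

Lemma loop_cat1 a b : path_cat a b 1 = x0.
Proof.
rewrite /path_cat ifF; last by apply/negbTE; rewrite -ltNge; lra.
by rewrite (_ : 2 * 1 - 1 = 1) ?loop1//; lra.
Qed.

Definition loop_mul a b : loop R x0 :=
  Loop (path_cat_continuous (@loop_continuous _ _ _ a) (@loop_continuous _ _ _ b)
          (loop_cat_proof a b)) (loop_cat0 a b) (loop_cat1 a b).

Definition loop_one : loop R x0 :=
  @Loop R X x0 (cst x0) (fun=> cvg_cst _) erefl erefl.

Lemma loop_inv0 a : path_rev a 0 = x0.
Proof. by rewrite /path_rev subr0 loop1. Qed.

Lemma loop_inv1 a : path_rev a 1 = x0.
Proof. by rewrite /path_rev subrr loop0. Qed.

Definition loop_inv a : loop R x0 :=
  Loop (path_rev_continuous (@loop_continuous _ _ _ a)) (loop_inv0 a) (loop_inv1 a).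

Definition pi1_mul (g h : pi1) : pi1 := \pi_pi1 (loop_mul (repr g) (repr h)).
Definition pi1_one : pi1 := \pi_pi1 loop_one.
Definition pi1_inv (g : pi1) : pi1 := \pi_pi1 (loop_inv (repr g)).

Lemma pi1_eqP a b : \pi_pi1 a = \pi_pi1 b <-> path_homotopic a b.
Proof.
split=> [/eqmodP/asboolP//|ab].
by apply/eqmodP/asboolP.
Qed.

Lemma repr_pi1 a : path_homotopic (repr (\pi_pi1 a)) a.
Proof. by apply/pi1_eqP; rewrite reprK. Qed.

Lemma pi1_mulE a b : pi1_mul (\pi_pi1 a) (\pi_pi1 b) = \pi_pi1 (loop_mul a b).
Proof.
apply/pi1_eqP; apply: path_homotopic_cat; try exact: repr_pi1.
exact: loop_cat_proof.
Qed.

Lemma pi1_invE a : pi1_inv (\pi_pi1 a) = \pi_pi1 (loop_inv a).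
Proof. by apply/pi1_eqP; apply: path_homotopic_rev; exact: repr_pi1. Qed.

Lemma pi1_mulA : associative pi1_mul.
Proof.
elim/quotP => a _; elim/quotP => b _; elim/quotP => c _.
rewrite (pi1_mulE b c) (pi1_mulE a b) (pi1_mulE a) (pi1_mulE _ c).
apply/pi1_eqP => /=.
by apply: path_catA; do ?exact: loop_continuous; exact: loop_cat_proof.
Qed.

Lemma pi1_mul1g : left_id pi1_one pi1_mul.
Proof.
elim/quotP => a _; rewrite pi1_mulE; apply/pi1_eqP => /=.
by rewrite -[X in cst X](loop0 a); apply: path_cat1p; exact: loop_continuous.
Qed.

Lemma pi1_mulg1 : right_id pi1_one pi1_mul.
Proof.
elim/quotP => a _; rewrite pi1_mulE; apply/pi1_eqP => /=.
by rewrite -[X in cst X](loop1 a); apply: path_catp1; exact: loop_continuous.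
Qed.

Lemma pi1_mulVg : left_inverse pi1_one pi1_inv pi1_mul.
Proof.
elim/quotP => a _; rewrite pi1_invE pi1_mulE; apply/pi1_eqP => /=.
by rewrite -[X in cst X](loop1 a); apply: path_catVp; exact: loop_continuous.
Qed.

Lemma pi1_mulgV : right_inverse pi1_one pi1_inv pi1_mul.
Proof.
elim/quotP => a _; rewrite pi1_invE pi1_mulE; apply/pi1_eqP => /=.
by rewrite -[X in cst X](loop0 a); apply: path_catpV; exact: loop_continuous.
Qed.

HB.instance Definition _ :=
  isGroup.Build pi1 pi1_mulA pi1_mul1g pi1_mulg1 pi1_mulVg pi1_mulgV.

End fundamental_group.

Definition closed_disc (R : realType) n : set 'rV[R]_n :=
  [set x | \sum_i x ord0 i ^+ 2 <= 1].
Definition open_disc (R : realType) n : set 'rV[R]_n :=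
  [set x | \sum_i x ord0 i ^+ 2 < 1].
Definition sphere (R : realType) n : set 'rV[R]_n :=
  [set x | \sum_i x ord0 i ^+ 2 = 1].

Arguments closed_disc : clear implicits.
Arguments open_disc : clear implicits.
Arguments sphere : clear implicits.

(* There being finitely many cells, the weak-topology axiom is automatic. *)
Record finite_CW (R : realType) (X : topologicalType) := FiniteCW {
  cell : finType;
  cell_dim : cell -> nat;
  char_map : forall i : cell, 'rV[R]_(cell_dim i) -> X;
  CW_hausdorff : hausdorff_space X;
  char_map_continuous : forall i,
    {within closed_disc R (cell_dim i), continuous (@char_map i)};
  char_map_inj : forall i, {in open_disc R (cell_dim i) &, injective (@char_map i)};
  char_map_open : forall i (V : set 'rV[R]_(cell_dim i)),
    open V -> V `<=` open_disc R (cell_dim i) ->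
    exists2 W : set X, open W &
      @char_map i @` V = W `&` (@char_map i @` open_disc R (cell_dim i));
  CW_partition : forall x : X,
    exists! i : cell, (@char_map i @` open_disc R (cell_dim i)) x;
  CW_boundary : forall i,
    @char_map i @` sphere R (cell_dim i) `<=`
      \bigcup_(j in [set j | (cell_dim j < cell_dim i)%N])
        (@char_map j @` open_disc R (cell_dim j)) }.

Definition skeleton (R : realType) (X : topologicalType) (K : finite_CW R X)
    (n : nat) : set X :=
  \bigcup_(i in [set i : cell K | (cell_dim i <= n)%N])
    (@char_map _ _ K i @` open_disc R (cell_dim i)).

Definition cellular (R : realType) (X : topologicalType) (K : finite_CW R X)
    (f : X -> X) : Prop :=
  continuous f /\ forall n, f @` skeleton K n `<=` skeleton K n.

Definition covering_map (E X : topologicalType) (p : E -> X) : Prop :=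
  [/\ continuous p, range p = setT &
      forall x, exists U : set X, exists S : set (set E),
        [/\ open U, U x, \bigcup_(V in S) V = p @^-1` U,
            forall V V', S V -> S V' -> V `&` V' !=set0 -> V = V' &
            forall V, S V ->
              [/\ open V, {in V &, injective p}, p @` V = U &
                  forall W, open W -> W `<=` V -> open (p @` W)]]].

(* [deck_path] identifies the deck transformations with [pi1]: the class of a
   loop [a] sends [cover_base] to the end of the lift of [a] starting there. *)
Record universal_cover (R : realType) (X : topologicalType) (x0 : X) :=
  UniversalCover {
  cover_space : topologicalType;
  cover_proj : cover_space -> X;
  cover_base : cover_space;
  deck : pi1 R x0 -> cover_space -> cover_space;
  cover_proj_covering : covering_map cover_proj;
  cover_simply_connected : simply_connected R cover_space;
  cover_proj_base : cover_proj cover_base = x0;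
  deck_continuous : forall g, continuous (deck g);
  deck1 : forall e, deck 1%g e = e;
  deckM : forall g h e, deck (g * h)%g e = deck g (deck h e);
  cover_proj_deck : forall g e, cover_proj (deck g e) = cover_proj e;
  deck_free : forall g e, deck g e = e -> g = 1%g;
  deck_transitive : forall e e', cover_proj e = cover_proj e' ->
    exists g, e' = deck g e;
  deck_path : forall (a : loop R x0) (gamma : R -> cover_space),
    continuous gamma -> gamma 0 = cover_base ->
    (forall t : R, 0 <= t <= 1 -> cover_proj (gamma t) = a t) ->
    deck (\pi_(pi1 R x0) a) cover_base = gamma 1 }.

(* With [f] and [ft] fixed, the last condition determines [phi]. *)
Definition is_lift (R : realType) (X : topologicalType) (x0 : X)
    (C : universal_cover R x0) (f : X -> X) (ft : cover_space C -> cover_space C)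
    (phi : {multiplicative pi1 R x0 -> pi1 R x0}) : Prop :=
  [/\ continuous ft,
      forall e, cover_proj (ft e) = f (cover_proj e) &
      forall g e, ft (deck g e) = deck (phi g) (ft e)].

(* The Brouwer degree of [g] over [0] on a bounded open set [U], where [g] is
   continuous and without zeros on the boundary: the signed count of zeros of
   C^1 maps having [0] as a regular value and arbitrarily close to [g].  For [e]
   small this count does not depend on [h]. *)
Definition has_brouwer_degree (R : realType) n (g : 'rV[R]_n -> 'rV[R]_n)
    (U : set 'rV[R]_n) (d : int) : Prop :=
  forall e : R, 0 < e -> exists h : 'rV[R]_n -> 'rV[R]_n,
    [/\ forall y, differentiable h y,
        continuous (fun y => 'J h y),
        forall y, closure U y -> `|h y - g y| < e,
        forall y, U y -> h y = 0 -> \det ('J h y) != 0 &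
        finite_set (U `&` h @^-1` [set 0]) /\
        d = \sum_(y \in U `&` h @^-1` [set 0]) sgz (\det ('J h y))].

(* Dold's definition, for [X] a compact ENR: [i] embeds [X] as a retract, under
   [r], of the open set [W], and the index of an isolated set [F] of fixed
   points is the degree of [id - i f r] near [i F], whose zeros in [W] are the
   images under [i] of the fixed points of [f]. *)
Definition has_fixed_point_index (R : realType) (X : topologicalType)
    (f : X -> X) (F : set X) (d : int) : Prop :=
  exists n (i : X -> 'rV[R]_n) (W U : set 'rV[R]_n) (r : 'rV[R]_n -> X),
    [/\ continuous i, open W, {in W, continuous r} &
        forall x, W (i x) /\ r (i x) = x] /\
    [/\ open U, compact (closure U), closure U `<=` W,
        i @` F `<=` U & closure U `&` (i @` [set x | f x = x]) `<=` i @` F] /\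
    has_brouwer_degree (fun y => y - i (f (r y))) U d.

Definition fixed_point_index (R : realType) (X : topologicalType)
    (f : X -> X) (F : set X) : int :=
  xget 0 [set d | has_fixed_point_index R f F d].

Section reidemeister.
Context (G : groupType) (phi : {multiplicative G -> G}).
Local Open Scope group_scope.

Lemma end_one : phi 1 = 1.
Proof. by apply: (mulgI (phi 1)); rewrite -gmulfM !mulg1. Qed.

Lemma end_inv g : phi g^-1 = (phi g)^-1.
Proof. by apply: (mulgI (phi g)); rewrite -gmulfM !mulgV end_one. Qed.

Definition reidemeister_conj (a b : G) : bool :=
  `[< exists g, b = g * a * (phi g)^-1 >].

Lemma reidemeister_conj_equiv : equiv_class_of reidemeister_conj.
Proof.
have sym a b : reidemeister_conj a b -> reidemeister_conj b a.
  move=> /asboolP[g ->]; apply/asboolP; exists g^-1.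
  by rewrite end_inv invgK !mulgA mulVg mul1g mulgVK.
split=> [a|a b|b a c].
- by apply/asboolP; exists 1; rewrite end_one invg1 mulg1 mul1g.
- by apply/idP/idP; exact: sym.
- move=> /asboolP[g ->] /asboolP[h ->]; apply/asboolP; exists (h * g).
  by rewrite gmulfM invgM !mulgA.
Qed.

Canonical reidemeister_rel := EquivRelPack reidemeister_conj_equiv.

Definition reidemeister := {eq_quot reidemeister_rel}.

HB.instance Definition _ := Choice.on reidemeister.
HB.instance Definition _ := EqQuotient.on reidemeister.

End reidemeister.

Record normal_subgroup (G : groupType) := NormalSubgroup {
  nsub_set :> set G;
  nsub1 : nsub_set 1%g;
  nsubM : forall a b, nsub_set a -> nsub_set b -> nsub_set (a * b)%g;
  nsubV : forall a, nsub_set a -> nsub_set a^-1%g;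
  nsubJ : forall a g, nsub_set a -> nsub_set (g * a * g^-1)%g }.

Section quotient_group.
Context (G : groupType) (N : normal_subgroup G).
Local Open Scope group_scope.

Definition same_coset (a b : G) : bool := `[< nsub_set N (a^-1 * b) >].

Lemma same_coset_equiv : equiv_class_of same_coset.
Proof.
have sym a b : same_coset a b -> same_coset b a.
  by move=> /asboolP/nsubV; rewrite invgM invgK => ?; apply/asboolP.
split=> [a|a b|b a c].
- by apply/asboolP; rewrite mulVg; exact: nsub1.
- by apply/idP/idP; exact: sym.
- move=> /asboolP ab /asboolP bc; apply/asboolP.
  by have := nsubM ab bc; rewrite mulgA mulgK.
Qed.

Canonical same_coset_rel := EquivRelPack same_coset_equiv.

Definition quotient_group := {eq_quot same_coset_rel}.

HB.instance Definition _ := Choice.on quotient_group.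
HB.instance Definition _ := EqQuotient.on quotient_group.

Local Notation Q := quotient_group.

Definition quo_mul (x y : Q) : Q := \pi_Q (repr x * repr y).
Definition quo_one : Q := \pi_Q 1.
Definition quo_inv (x : Q) : Q := \pi_Q (repr x)^-1.

Lemma quo_eqP (a b : G) : \pi_Q a = \pi_Q b <-> nsub_set N (a^-1 * b).
Proof.
by split=> [/eqmodP/asboolP//|ab]; apply/eqmodP/asboolP.
Qed.

Lemma repr_quo (a : G) : nsub_set N ((repr (\pi_Q a))^-1 * a).
Proof. by apply/quo_eqP; rewrite reprK. Qed.

Lemma quo_mulE (a b : G) : quo_mul (\pi_Q a) (\pi_Q b) = \pi_Q (a * b).
Proof.
apply/quo_eqP; set a' := repr _; set b' := repr _.
have -> : (a' * b')^-1 * (a * b) =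
    (b'^-1 * (a'^-1 * a) * b'^-1^-1) * (b'^-1 * b).
  by rewrite invgM invgK !mulgA mulgK.
by apply: nsubM; [apply: nsubJ|]; exact: repr_quo.
Qed.

Lemma quo_invE (a : G) : quo_inv (\pi_Q a) = \pi_Q a^-1.
Proof.
apply/quo_eqP; set a' := repr _; rewrite invgK.
have -> : a' * a^-1 = a' * (a'^-1 * a)^-1 * a'^-1.
  by rewrite invgM invgK !mulgA mulgK.
by apply: nsubJ; apply: nsubV; exact: repr_quo.
Qed.

Lemma quo_mulA : associative quo_mul.
Proof.
by elim/quotP => a _; elim/quotP => b _; elim/quotP => c _;
rewrite (quo_mulE b c) (quo_mulE a b) (quo_mulE a) (quo_mulE _ c) mulgA.
Qed.

Lemma quo_mul1g : left_id quo_one quo_mul.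
Proof. by elim/quotP => a _; rewrite quo_mulE mul1g. Qed.

Lemma quo_mulg1 : right_id quo_one quo_mul.
Proof. by elim/quotP => a _; rewrite quo_mulE mulg1. Qed.

Lemma quo_mulVg : left_inverse quo_one quo_inv quo_mul.
Proof. by elim/quotP => a _; rewrite quo_invE quo_mulE mulVg. Qed.

Lemma quo_mulgV : right_inverse quo_one quo_inv quo_mul.
Proof. by elim/quotP => a _; rewrite quo_invE quo_mulE mulgV. Qed.

HB.instance Definition _ :=
  isGroup.Build Q quo_mulA quo_mul1g quo_mulg1 quo_mulVg quo_mulgV.

Definition quo_map (a : G) : Q := \pi_Q a.

End quotient_group.

Record finite_observer (G : groupType) (phi : {multiplicative G -> G}) :=
  FiniteObserver {
  obs_nsub :> normal_subgroup G;
  obs_finite_index : finite_set [set: quotient_group obs_nsub];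
  obs_stable : phi @` obs_nsub `<=` obs_nsub }.

Section observer.
Context (G : groupType) (phi : {multiplicative G -> G}) (N : finite_observer phi).
Local Open Scope group_scope.

Definition induced_end (x : quotient_group N) : quotient_group N :=
  quo_map N (phi (repr x)).

Lemma induced_endE (a : G) : induced_end (quo_map N a) = quo_map N (phi a).
Proof.
apply/quo_eqP.
rewrite -end_inv -gmulfM; apply: (@obs_stable _ _ N).
exact/imageP/repr_quo.
Qed.

Lemma induced_endM : {morph induced_end : x y / x * y}.
Proof.
elim/quotP => a _; elim/quotP => b _.
have E (u v : G) : quo_map N u * quo_map N v = quo_map N (u * v).
  exact: quo_mulE.
change (induced_end (quo_map N a * quo_map N b) =
  induced_end (quo_map N a) * induced_end (quo_map N b)).
by rewrite E !induced_endE E gmulfM.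
Qed.

HB.instance Definition _ :=
  isMultiplicative.Build (quotient_group N) (quotient_group N)
    induced_end induced_endM.

Definition observe (alpha : reidemeister phi) : reidemeister induced_end :=
  \pi_(reidemeister induced_end) (quo_map N (repr alpha)).

End observer.

(* An element of the free abelian group on [T] is a function [T -> int] of
   finite support.  The sums below run over the support, and sums over an
   infinite support, like the cardinal of [fset_set] of an infinite set, are 0
   by convention.  The Reidemeister trace does have finite support when the
   space is compact: the fixed point classes are open in the fixed point set,
   and an empty class has index 0. *)

Definition support_of (T : choiceType) (c : T -> int) : set T :=
  [set t | c t != 0].
Definition pushforward (T S : choiceType) (q : T -> S) (c : T -> int) (s : S) : int :=
  \sum_(t \in q @^-1` [set s]) c t.
Definition l1_norm (T : choiceType) (c : T -> int) : int :=
  \sum_(t \in [set: T]) `|c t|.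

Section trace.
Context (R : realType) (X : topologicalType) (x0 : X) (C : universal_cover R x0).
Context (f : X -> X) (ft : cover_space C -> cover_space C).
Context (phi : {multiplicative pi1 R x0 -> pi1 R x0}).

Definition fixed_point_class (a : pi1 R x0) : set X :=
  @cover_proj _ _ _ C @` [set e | deck a (ft e) = e].

(* Conjugate representatives define the same fixed point class, so that the
   choice of [repr alpha] is immaterial. *)
Definition RT (alpha : reidemeister phi) : int :=
  fixed_point_index R f (fixed_point_class (repr alpha)).

Definition essential_classes : set (reidemeister phi) := support_of RT.

Definition nielsen_number : nat := #|` fset_set essential_classes|.

Context (N : finite_observer phi).

Definition observed_RT : reidemeister (induced_end (N := N)) -> int :=
  pushforward (@observe _ phi N) RT.

Definition R_obs : nat := #|` fset_set (@observe _ phi N @` essential_classes)|.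
Definition V_obs : nat := #|` fset_set (support_of observed_RT)|.
Definition M_obs : int := l1_norm observed_RT.
Definition col_obs : int := nielsen_number%:Z - R_obs%:Z.
Definition can_obs : rat := (l1_norm RT - M_obs)%:~R / 2.

End trace.

(* Main.v *)
(* All quantities are meaningful because the Reidemeister trace has finite
   support: the fixed point classes are disjoint, open in the fixed point set
   (near a fixed point of [a ft], membership is read off in one sheet of the
   covering) and cover it, so by compactness only finitely many are nonempty;
   and the empty class has index 0, since [id - i f r] is then bounded away from
   0 and so are its approximations.  If [N'] is contained in [N], [observe N]
   factors through [observe N'], so that passing from [N'] to [N] is a further
   pushforward; this can only shrink the image, the support and the l1 norm.
   As |x| + |y| - |x + y| is even, the l1 norm drops by an even number. *)

Require Import Defs.
From HB Require Import structures.
From mathcomp Require Import all_boot all_order all_algebra monoid generic_quotient.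
From mathcomp Require Import finmap zify.
From mathcomp Require Import all_classical all_reals all_analysis.

Set Implicit Arguments.
Unset Strict Implicit.
Unset Printing Implicit Defensive.

Import Order.TTheory GRing.Theory Num.Theory numFieldNormedType.Exports.

Local Open Scope classical_set_scope.
Local Open Scope ring_scope.

(** * Factorization of maps, cardinals, parity of integer norms *)

Lemma factor_through (T S U : choiceType) (t0 : T) (q' : T -> S) (q : T -> U) :
  (forall a b, q' a = q' b -> q a = q b) -> exists r, q = r \o q'.
Proof.
(* [r] picks some [q']-preimage of [s]; off the range of [q'] the default [t0] is harmless. *)
move=> q'q; exists (fun s => q (xget t0 [set a | q' a = s])).
apply/funext => a /=; apply: q'q.
by case: xgetP => [b _ /= <-//|/(_ a)]; case.
Qed.

Lemma sub_card_fset_set (T : choiceType) (A B : set T) :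
  finite_set B -> A `<=` B -> (#|` fset_set A| <= #|` fset_set B|)%N.
Proof.
move=> Bfin AB; apply/fsubset_leq_card.
by rewrite -fset_set_sub//; exact: sub_finite_set Bfin.
Qed.

Lemma card_fset_set_image (T U : choiceType) (g : T -> U) (A : set T) :
  finite_set A -> (#|` fset_set (g @` A)| <= #|` fset_set A|)%N.
Proof. by move=> Afin; rewrite fset_set_image// leq_imfset_card. Qed.

(** An integer and its absolute value have the same parity, so the defect in the triangle inequality
    is even. *)
Lemma normD_parity (x y : int) :
  exists k : nat, `|x| + `|y| = `|x + y| + k.*2%:Z.
Proof. by exists `|(`|x| + `|y| - `|x + y|)%R|./2; lia. Qed.

Lemma sum_norm_parity (I : Type) (s : seq I) (P : pred I) (F : I -> int) :
  exists k : nat, \sum_(i <- s | P i) `|F i| = `|\sum_(i <- s | P i) F i| + k.*2%:Z.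
Proof.
apply: (big_ind2 (fun x y : int => exists k : nat, x = `|y| + k.*2%:Z)) => //.
- by exists 0%N; rewrite normr0.
- move=> x1 x y1 y [k ->] [l ->]; have [m xyE] := normD_parity x y.
  by exists (k + l + m)%N; rewrite addrACA xyE; lia.
- by exists 0%N; rewrite addr0.
Qed.

(* The measure-theoretic [pushforward] shadows the one of [Defs]. *)
Local Notation pushforward := Defs.pushforward.

(** * Finitely supported functions and their pushforwards *)

Lemma support_ofPn (T : choiceType) (c : T -> int) (A : {fset T}) t :
  support_of c `<=` [set` A] -> t \notin A -> c t = 0.
Proof. by move=> cA; apply: contraNeq => ct; exact: cA. Qed.

Lemma l1_normE (T : choiceType) (c : T -> int) (A : {fset T}) :
  support_of c `<=` [set` A] -> l1_norm c = \sum_(t <- A) `|c t|.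
Proof.
by move=> cA; apply: fsbigTE => t /(support_ofPn cA) ->; rewrite normr0.
Qed.

Lemma finite_support_fset (T : choiceType) (c : T -> int) :
  finite_set (support_of c) -> exists A : {fset T}, support_of c `<=` [set` A].
Proof. by move=> /finite_fsetP[A ->]; exists A. Qed.

Section pushforward.
Context {T S : choiceType}.
Implicit Types (q : T -> S) (c : T -> int).

Lemma pushforwardE q c (A : {fset T}) s : support_of c `<=` [set` A] ->
  pushforward q c s = \sum_(t <- A | q t == s) c t.
Proof.
move=> cA; rewrite bigfs//.
  by apply: eq_fsbigl; apply/seteqP; split => t /= /eqP.
by move=> t _ tA; exact: support_ofPn cA tA.
Qed.

Lemma support_pushforward q c :
  support_of (pushforward q c) `<=` q @` support_of c.
Proof.
move=> s /= /eqP; apply: contra_notP => sc; apply: fsbig1 => t /= qt.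
by apply/eqP; apply: contra_notT sc => ct; exists t.
Qed.

Lemma finite_support_pushforward q c :
  finite_set (support_of c) -> finite_set (support_of (pushforward q c)).
Proof.
move=> cfin; apply: sub_finite_set; first exact: support_pushforward.
exact: finite_image.
Qed.

Lemma support_pushforward_imfset q c (A : {fset T}) : support_of c `<=` [set` A] ->
  support_of (pushforward q c) `<=` [set` (q @` A)%fset].
Proof.
move=> cA s /support_pushforward[t /cA tA <-] /=.
exact: in_imfset.
Qed.

Lemma l1_norm_pushforward q c : finite_set (support_of c) ->
  exists k : nat, l1_norm c = l1_norm (pushforward q c) + k.*2%:Z.
Proof.
move=> /finite_support_fset[A cA].
rewrite (l1_normE cA) (l1_normE (support_pushforward_imfset cA)).
(* Group [A] by the fibres of [q]: each fibre loses an even amount of norm. *)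
rewrite (partition_big_imfset _ q)/=.
apply: (big_ind2 (fun x y : int => exists k : nat, x = y + k.*2%:Z))
  => [|x1 x y1 y|s _].
- by exists 0%N.
- by move=> [k ->] [l ->]; exists (k + l)%N; lia.
- by rewrite (pushforwardE _ _ cA); exact: sum_norm_parity.
Qed.

End pushforward.

(** Finite support matters: sums over infinite supports are 0 by convention, which breaks the
    regrouping of a fibre of [r \o q] into fibres of [q]. *)
Lemma pushforward_comp (T S U : choiceType) (q : T -> S) (r : S -> U) (c : T -> int) :
  finite_set (support_of c) ->
  pushforward (r \o q) c = pushforward r (pushforward q c).
Proof.
move=> /finite_support_fset[A cA]; apply/funext => u.
rewrite (pushforwardE _ _ cA) (pushforwardE _ _ (support_pushforward_imfset cA)).
rewrite big_mkcond (partition_big_imfset _ q)/= [RHS]big_mkcond/=.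
apply: eq_bigr => s _; rewrite (pushforwardE _ _ cA).
(* On the fibre of [q] over [s], the condition [r (q t) == u] is constantly [r s == u]. *)
case: ifPn => rs; last by rewrite big1// => t /eqP ->; rewrite (negbTE rs).
by apply: eq_bigr => t /eqP ->; rewrite rs.
Qed.

(** * Observation of Reidemeister classes and refinement *)

Lemma quo_mapM (G : groupType) (N : normal_subgroup G) (a b : G) :
  quo_map N (a * b)%g = (quo_map N a * quo_map N b)%g.
Proof. by rewrite /quo_map -quo_mulE. Qed.

Lemma quo_mapV (G : groupType) (N : normal_subgroup G) (a : G) :
  quo_map N a^-1%g = (quo_map N a)^-1%g.
Proof. by rewrite /quo_map -quo_invE. Qed.

(** Lifting the conjugating element of the quotient to [G] leaves [N] only as a membership
    condition, which is visibly monotone in [N]. *)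
Lemma observe_eqP (G : groupType) (phi : {multiplicative G -> G})
    (N : finite_observer phi) (alpha beta : reidemeister phi) :
  observe N alpha = observe N beta <->
  exists g, (N : set G) ((repr beta)^-1 * (g * repr alpha * (phi g)^-1))%g.
Proof.
have conjE g : (quo_map N g * quo_map N (repr alpha) *
    (induced_end (quo_map N g))^-1)%g = quo_map N (g * repr alpha * (phi g)^-1)%g.
  by rewrite induced_endE -quo_mapV -!quo_mapM.
split=> [/eqmodP/asboolP[x]|[g Ng]].
  rewrite -(reprK x) -/(quo_map N _) conjE => /quo_eqP.
  by exists (repr x).
by apply/eqmodP/asboolP; exists (quo_map N g); rewrite conjE; apply/quo_eqP.
Qed.

Lemma observe_coarser (G : groupType) (phi : {multiplicative G -> G})
    (N N' : finite_observer phi) (alpha beta : reidemeister phi) :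
  (N' : set G) `<=` N -> observe N' alpha = observe N' beta ->
  observe N alpha = observe N beta.
Proof.
by move=> N'N /observe_eqP[g N'g]; apply/observe_eqP; exists g; exact: N'N.
Qed.

(** * Compactness of finite CW complexes *)

Lemma sum_squares_continuous (R : realType) n :
  continuous (fun x : 'rV[R]_n => \sum_i x ord0 i ^+ 2).
Proof.
apply: continuous_big => [z|i _ x]; first exact: add_continuous.
apply: (@continuous_comp _ _ _ (fun x : 'rV[R]_n => x ord0 i) (fun y => y ^+ 2)).
  exact: coord_continuous.
exact: exprn_continuous.
Qed.

Lemma closed_disc_compact (R : realType) n : compact (closed_disc R n).
Proof.
apply: bounded_closed_compact.
  exists 1; split; first exact: num_real.
  move=> M M1 x /= x1; apply: (le_trans _ (ltW M1)).
  (* The norm of a row vector is its largest coordinate in absolute value, and the square of each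
     coordinate is at most the sum of squares. *)
  rewrite [leLHS]/Num.norm/= mx_normrE; apply/bigmax_leP; split => //= -[i j] _ /=.
  rewrite (ord1 i) -(@ler_sqr _ _ 1) ?nnegrE// expr1n real_normK ?num_real//.
  apply: le_trans x1; rewrite (bigD1 j)//= lerDl sumr_ge0// => k _.
  exact: sqr_ge0.
have -> : closed_disc R n =
    (fun x : 'rV[R]_n => \sum_i x ord0 i ^+ 2) @^-1` [set y | y <= 1] by [].
apply: preimage_closed; last exact: closed_le.
by move=> x _; exact: sum_squares_continuous.
Qed.

(** The closed cells are finitely many compact images of discs, and they cover [X]. *)
Lemma finite_CW_compact (R : realType) (X : topologicalType) :
  finite_CW R X -> compact [set: X].
Proof.
move=> K; have -> : [set: X] =
    \big[setU/set0]_(i : cell K) (@char_map _ _ K i @` closed_disc R (cell_dim i)).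
  apply/seteqP; split => // x _; have [i [[y yi <-] _]] := CW_partition K x.
  by rewrite (bigD1 i)//=; left; exists y => //; exact: ltW.
apply: bigsetU_compact => i _; apply: continuous_compact.
  exact: char_map_continuous.
exact: closed_disc_compact.
Qed.

(** * The fixed point set and the index of its empty subset *)

Lemma fixed_points_closed (X : topologicalType) (f : X -> X) :
  hausdorff_space X -> continuous f -> closed [set x | f x = x].
Proof.
move=> hX cf x clx; apply: hX => A B fxA xB.
(* A fixed point close enough to [x] lies in both [A] and [B]. *)
have fA : nbhs x (f @^-1` A) by exact: cf.
have [y [/= yE [/= Ay By]]] := clx _ (filterI fA xB).
by exists y; split => //; rewrite -yE.
Qed.

Lemma fixed_point_index_set0 (R : realType) (X : topologicalType) (f : X -> X) :
  continuous f -> fixed_point_index R f set0 = 0.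
Proof.
(* If no index exists, [xget] returns its default 0. *)
move=> cf; rewrite /fixed_point_index; case: xgetP => // d _ /=.
move=> [n [i [W [U [r [[ci Wop cr ir] [[Uop Uco UW _ Ufix] deg]]]]]]].
pose g (y : 'rV[R]_n) := y - i (f (r y)).
have g_neq0 y : closure U y -> g y != 0.
  (* A zero [y] of [g] would be the image under [i] of the fixed point [r y], but no such image lies
     in [closure U]. *)
  move=> Uy; apply/negP => /eqP/subr0_eq yE.
  have fry : f (r y) = r y by rewrite {2}yE (ir _).2.
  have := Ufix y; rewrite image_set0; apply; split => //.
  by exists (r y) => //=; rewrite {2}yE fry.
(* Empty [U] is treated apart, as [g] has no minimum to attain there. *)
have [U0|/set0P U_neq0] := eqVneq U set0.
  have [h [_ _ _ _ [_ ->]]] := deg 1 ltr01.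
  by rewrite U0 set0I fsbig_set0.
have cg : {within closure U, continuous (fun y => `|g y|)}.
  apply: continuous_in_subspaceT => y; rewrite inE => /UW Wy.
  apply: (@continuous_comp _ _ _ g (fun z => `|z|)); last exact: norm_continuous.
  apply: (@continuousB _ _ _ idfun (fun z => i (f (r z)))); first exact: cvg_id.
  apply: (@continuous_comp _ _ _ (f \o r) i); last exact: ci.
  apply: (@continuous_comp _ _ _ r f); last exact: cf.
  by apply: cr; rewrite inE.
have [|y0] := compact_EVT_min _ Uco cg.
  by case: U_neq0 => y Uy; exists y; exact: subset_closure.
rewrite inE => /g_neq0 gy0 gmin.
(* An approximation closer to [g] than the minimum of its norm has no zero in [U], so its signed
   count is an empty sum. *)
have [|h [_ _ hg _ [_ ->]]] := deg `|g y0|; first by rewrite normr_gt0.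
apply: fsbig1 => y [Uy /= hy].
have cUy : closure U y by exact: subset_closure.
by have := hg _ cUy; rewrite hy sub0r normrN ltNge gmin// inE.
Qed.

(** * Fixed point classes and finiteness of the Reidemeister trace *)

Section fixed_point_classes.
Context (R : realType) (X : topologicalType) (x0 : X) (C : universal_cover R x0).
Context (f : X -> X) (ft : cover_space C -> cover_space C).
Context (phi : {multiplicative pi1 R x0 -> pi1 R x0}) (f_lift : is_lift f ft phi).

(** The translation [deck g] carries fixed points of the first lift to fixed points of the conjugate
    one, without changing their projections. *)
Lemma fixed_point_class_conj (a g : pi1 R x0) :
  fixed_point_class ft a `<=` fixed_point_class ft (g * a * (phi g)^-1)%g.
Proof.
have [_ _ ftD] := f_lift.
move=> _ [e /= ae <-]; exists (deck g e) => /=; last exact: cover_proj_deck.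
by rewrite ftD -deckM mulgVK deckM ae.
Qed.

Lemma fixed_point_class_fixed (a : pi1 R x0) :
  fixed_point_class ft a `<=` [set x | f x = x].
Proof.
have [_ pft _] := f_lift.
by move=> _ [e /= ae <-]; rewrite -pft -(cover_proj_deck a) ae.
Qed.

Lemma fixed_point_class_cover (x : X) : f x = x ->
  exists alpha : reidemeister phi, fixed_point_class ft (repr alpha) x.
Proof.
have [_ pft _] := f_lift; have [_ psurj _] := cover_proj_covering C.
move=> fx; have [e _ ex] : range (@cover_proj _ _ _ C) x by rewrite psurj.
have [g ge] : exists g, e = deck g (ft e).
  by apply: deck_transitive; rewrite pft ex fx.
exists (\pi_(reidemeister phi) g)%qT.
(* The chosen representative of the class is only twisted conjugate to [g]. *)
have /eqmodP/asboolP[h ->] :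
    (\pi_(reidemeister phi) g =
     \pi_(reidemeister phi) (repr (\pi_(reidemeister phi) g)))%qT.
  by rewrite reprK.
by apply: fixed_point_class_conj; exists e.
Qed.

Lemma fixed_point_class_disjoint (alpha beta : reidemeister phi) (x : X) :
  fixed_point_class ft (repr alpha) x -> fixed_point_class ft (repr beta) x ->
  alpha = beta.
Proof.
have [_ _ ftD] := f_lift.
move=> [e /= ae <-] [e' /= be'] /esym /deck_transitive[g e'E].
rewrite -[alpha]reprK -[beta]reprK; apply/eqmodP/asboolP; exists g.
set a := repr alpha in ae *; set b := repr beta in be' *.
(* This element fixes [ft e], and the deck action is free; solving for [b] gives the twisted
   conjugacy. *)
have : (a^-1 * g^-1 * b * phi g)%g = 1%g.
  apply: (@deck_free _ _ _ C _ (ft e)).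
  rewrite !deckM -ftD -e'E be' e'E -!deckM -mulgA mulVg mulg1.
  by rewrite -{1}ae -deckM mulVg deck1.
move=> /(congr1 (fun z => g * a * z * (phi g)^-1))%g.
by rewrite mulg1 !mulgA mulgK mulgK mulgV mul1g => <-.
Qed.

Lemma fixed_point_class_open (a : pi1 R x0) :
  exists2 W : set X, open W & fixed_point_class ft a = [set x | f x = x] `&` W.
Proof.
have [ft_cont pft _] := f_lift.
have [_ _ pcov] := cover_proj_covering C.
pose good (O : set X) :=
  open O /\ [set x | f x = x] `&` O `<=` fixed_point_class ft a.
have loc x : fixed_point_class ft a x -> exists2 O, good O & O x.
  move=> [e /= ae <-]; have [U [S [_ Ue US _ sheet]]] := pcov (cover_proj e).
  have [V SV Ve] : (\bigcup_(V in S) V) e by rewrite US.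
  have [Vop pinj _ pop] := sheet V SV.
  (* For [z] in [V'] over a fixed point, [z] and [deck a (ft z)] lie in one sheet and have the same
     projection, hence coincide. *)
  pose V' := V `&` (fun e => deck a (ft e)) @^-1` V.
  have V'op : open V'.
    apply: openI => //; apply: open_comp Vop => z _.
    apply: (@continuous_comp _ _ _ ft (deck a)); first exact: ft_cont.
    exact: deck_continuous.
  exists (@cover_proj _ _ _ C @` V').
    split; first by apply: pop => // z [].
    move=> y [/= fy [z [Vz Vaz] zy]]; exists z => //=.
    by apply: pinj; rewrite ?inE// cover_proj_deck pft zy.
  by exists e => //; split => //=; rewrite /preimage/= ae.
exists (\bigcup_(O in good) O); first by apply: bigcup_open => O; case.
apply/seteqP; split => [x ax|x [fx [B [_ gB] Bx]]]; last exact: gB.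
split; first exact: fixed_point_class_fixed ax.
by have [B gB Bx] := loc x ax; exists B.
Qed.

Lemma nonempty_fixed_point_classes_finite :
  hausdorff_space X -> compact [set: X] -> continuous f ->
  finite_set [set alpha : reidemeister phi |
    fixed_point_class ft (repr alpha) !=set0].
Proof.
move=> hX cX cf.
have Fix_compact : compact [set x | f x = x].
  by apply: (subclosed_compact _ cX) => //; exact: fixed_points_closed.
pose Xp : ptopologicalType := HB.pack (X : Type) X (isPointed.Build X x0).
have : @cover_compact Xp [set x | f x = x] by rewrite -compact_cover.
rewrite cover_compactE => /(_ (reidemeister phi) setT
  (fun alpha => fixed_point_class ft (repr alpha))) [].
- have /choice[W WP] : forall alpha : reidemeister phi, exists W : set X,
      open W /\ fixed_point_class ft (repr alpha) = [set x | f x = x] `&` W.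
    by move=> alpha; have [W ? ?] := fixed_point_class_open (repr alpha); exists W.
  by exists W => alpha _; have [] := WP alpha.
- by move=> x /fixed_point_class_cover[alpha ?]; exists alpha.
(* A point of a nonempty class also lies in a class of the finite subcover; disjointness identifies
   the two. *)
move=> D _ Dcov; apply: (sub_finite_set _ (finite_fset D)) => alpha [x ax].
have [beta /= Dbeta bx] := Dcov x (fixed_point_class_fixed ax).
by rewrite (fixed_point_class_disjoint ax bx).
Qed.

Lemma finite_support_RT :
  hausdorff_space X -> compact [set: X] -> continuous f ->
  finite_set (support_of (RT f ft (phi := phi))).
Proof.
move=> hX cX cf; apply: sub_finite_set (nonempty_fixed_point_classes_finite hX cX cf).
move=> alpha; rewrite /support_of /RT/= => /eqP idx_neq0; apply/set0P/eqP => class0.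
by apply: idx_neq0; rewrite class0 fixed_point_index_set0.
Qed.

End fixed_point_classes.

(** * Monotonicity under refinement and integrality of the cancellation mass *)

Theorem proposition2p5 (R : realType) (X : topologicalType)
    (K : finite_CW R X) (X_connected : connected [set: X]) (x0 : X)
    (C : universal_cover R x0)
    (f : X -> X) (f_cellular : cellular K f)
    (ft : cover_space C -> cover_space C) (phi : {multiplicative pi1 R x0 -> pi1 R x0})
    (f_lift : is_lift f ft phi) :
  (forall N N' : finite_observer phi, (N' : set (pi1 R x0)) `<=` N ->
    [/\ (R_obs f ft N <= R_obs f ft N')%N,
        (V_obs f ft N <= V_obs f ft N')%N,
        M_obs f ft N <= M_obs f ft N',
        col_obs f ft N' <= col_obs f ft N &
        can_obs f ft N' <= can_obs f ft N]) /\
  (forall N : finite_observer phi,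
    exists k : nat, can_obs f ft N = k%:R).
Proof.
have RTfin : finite_set (support_of (RT f ft (phi := phi))).
  apply: finite_support_RT => //; first exact: CW_hausdorff K.
    exact: finite_CW_compact K.
  by case: f_cellular.
split=> [N N' N'N|N]; last first.
  (* The norm drops by [k.*2], so the cancellation mass is [k]. *)
  have [k kE] := l1_norm_pushforward (@observe _ phi N) RTfin.
  exists k; rewrite /can_obs /M_obs /observed_RT kE addrC addKr.
  by rewrite -muln2 PoszM intrM mulfK.
have [r rE] := factor_through (\pi_(reidemeister phi) 1%g)%qT
  (fun alpha beta => @observe_coarser _ _ N N' alpha beta N'N).
have obsfin : finite_set (support_of (observed_RT f ft (N := N'))).
  exact: finite_support_pushforward.
(* From here the trace observed at [N'] plays the part of the full trace, with [r] as the
   observation map. *)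
have obsE : observed_RT f ft (N := N) = pushforward r (observed_RT f ft (N := N')).
  by rewrite /observed_RT rE pushforward_comp.
have R_le : (R_obs f ft N <= R_obs f ft N')%N.
  rewrite /R_obs rE -image_comp.
  by apply: card_fset_set_image; exact: finite_image.
have M_le : M_obs f ft N <= M_obs f ft N'.
  rewrite /M_obs obsE; have [k ->] := l1_norm_pushforward r obsfin.
  by rewrite lerDl.
split=> //.
- rewrite /V_obs obsE; apply: leq_trans (card_fset_set_image r obsfin).
  apply: sub_card_fset_set; first exact: finite_image.
  exact: support_pushforward.
- by rewrite /col_obs lerD2l lerN2 lez_nat.
- by rewrite /can_obs ler_pM2r ?invr_gt0// ler_int lerD2l lerN2.
Qed.
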